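(* Let $G$ be the wallpaper group of type p3, i.e. $G=\langle x,y,\rho \mid (x,y),\ x^\rho=x^{-1}y,\ y^\rho=x^{-1},\ \rho^3\rangle$, and let $A=\langle x,y\rangle$. Let $\tau:G\to G$ be the map with $\tau(g)=g$ for $g\notin A\rho\cup A\rho^2$ and $\tau(g)=g^\rho$ for $g\in A\rho\cup A\rho^2$. Then the weak Cayley table group $\mathcal W(G)$ is generated by $\mathcal W_0(G)$ and $\tau$ (in particular $\tau \in \mathcal W(G)$).
   Context: Notation: $g^h=h^{-1}gh$, $(g,h)=g^{-1}h^{-1}gh$. For a group $G$, $\sim$ denotes conjugacy in $G$. The weak Cayley table group $\mathcal W(G)$ is the group (under composition) of all bijections $f:G\to G$ such that $f(g_1g_2)\sim f(g_1)f(g_2)$ for all $g_1,g_2\in G$. It contains $\operatorname{Aut}(G)$ and the inversion map $\iota:g\mapsto g^{-1}$; $\mathcal W_0(G)=\langle \operatorname{Aut}(G),\iota\rangle$. *)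

(* Defs.v *)
From HB Require Import structures.
From mathcomp Require Import all_boot.
From mathcomp Require Import boolp classical_sets.

Set Implicit Arguments.
Unset Strict Implicit.
Unset Printing Implicit Defensive.

Local Open Scope quotient_scope.
Local Open Scope classical_set_scope.
Local Open Scope group_scope.

(** * Groups given by generators and relations *)

(* Group words as uninterpreted terms: none of the group laws hold here, they
   are imposed, together with the relations, by [peq]. *)
Inductive gterm (I : Type) :=
  | Gen of I
  | One
  | Mul of gterm I & gterm I
  | Inv of gterm I.
Arguments One {I}.

HB.instance Definition _ (I : Type) := gen_eqMixin (gterm I).
HB.instance Definition _ (I : Type) := gen_choiceMixin (gterm I).
(* This makes the library notations x ^ y, [~ x, y], x ^+ n available on
   terms. *)
HB.instance Definition _ (I : Type) := hasMul.Build (gterm I) (@Mul I).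
HB.instance Definition _ (I : Type) := hasOne.Build (gterm I) (@One I).
HB.instance Definition _ (I : Type) := hasInv.Build (gterm I) (@Inv I).

(* The least congruence containing the group laws and the relations l = r,
   for (l, r) in R. *)
Inductive peq (I : Type) (R : set (gterm I * gterm I)) :
    gterm I -> gterm I -> Prop :=
  | peq_refl t : peq R t t
  | peq_sym t u : peq R t u -> peq R u t
  | peq_trans t u v : peq R t u -> peq R u v -> peq R t v
  | peq_mul t t' u u' : peq R t t' -> peq R u u' -> peq R (t * u) (t' * u')
  | peq_inv t t' : peq R t t' -> peq R t^-1 t'^-1
  | peq_mulA t u v : peq R (t * (u * v)) ((t * u) * v)
  | peq_mul1g t : peq R (1 * t) t
  | peq_mulg1 t : peq R (t * 1) t
  | peq_mulVg t : peq R (t^-1 * t) 1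
  | peq_mulgV t : peq R (t * t^-1) 1
  | peq_rel l r : R (l, r) -> peq R l r.

Section PresentedGroup.
Variables (I : Type) (R : set (gterm I * gterm I)).

Definition peqb (t u : gterm I) : bool := `[< peq R t u >].

Lemma peqb_equiv : equiv_class_of peqb.
Proof.
split=> [t|t u|u t v].
- exact/asboolP/peq_refl.
- by apply/asboolP/asboolP; apply: peq_sym.
- by move=> /asboolP tu /asboolP uv; apply/asboolP; apply: peq_trans tu uv.
Qed.

Canonical peqb_equiv_rel := EquivRelPack peqb_equiv.

Definition presented := {eq_quot peqb}.
HB.instance Definition _ := Choice.on presented.
HB.instance Definition _ := EqQuotient.on presented.

Definition presented_pi (t : gterm I) : presented := \pi_presented t.

Lemma presented_piP t u : presented_pi t = presented_pi u <-> peq R t u.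
Proof. by split=> [/eqmodP/asboolP//|tu]; apply/eqmodP/asboolP. Qed.

Lemma presented_reprK (a : presented) : presented_pi (repr a) = a.
Proof. exact: reprK. Qed.

Lemma peq_repr t : peq R (repr (presented_pi t)) t.
Proof. by apply/presented_piP; rewrite presented_reprK. Qed.

Definition presented_one : presented := presented_pi 1.
Definition presented_mul (a b : presented) : presented :=
  presented_pi (repr a * repr b).
Definition presented_inv (a : presented) : presented :=
  presented_pi (repr a)^-1.

Lemma presented_mulA : associative presented_mul.
Proof.
move=> a b c; apply/presented_piP.
apply: (peq_trans (peq_mul (peq_refl R _) (peq_repr _))).
apply: (peq_trans (peq_mulA R _ _ _)).
exact: (peq_mul (peq_sym (peq_repr _)) (peq_refl R _)).
Qed.

Lemma presented_mul1g : left_id presented_one presented_mul.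
Proof.
move=> a; rewrite -[RHS]presented_reprK; apply/presented_piP.
apply: (peq_trans (peq_mul (peq_repr _) (peq_refl R _))); exact: peq_mul1g.
Qed.

Lemma presented_mulg1 : right_id presented_one presented_mul.
Proof.
move=> a; rewrite -[RHS]presented_reprK; apply/presented_piP.
apply: (peq_trans (peq_mul (peq_refl R _) (peq_repr _))); exact: peq_mulg1.
Qed.

Lemma presented_mulVg :
  left_inverse presented_one presented_inv presented_mul.
Proof.
move=> a; apply/presented_piP.
apply: (peq_trans (peq_mul (peq_repr _) (peq_refl R _))); exact: peq_mulVg.
Qed.

Lemma presented_mulgV :
  right_inverse presented_one presented_inv presented_mul.
Proof.
move=> a; apply/presented_piP.
apply: (peq_trans (peq_mul (peq_refl R _) (peq_repr _))); exact: peq_mulgV.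
Qed.

HB.instance Definition _ := isGroup.Build presented
  presented_mulA presented_mul1g presented_mulg1
  presented_mulVg presented_mulgV.

Definition pgen (i : I) : presented := presented_pi (Gen i).

End PresentedGroup.

(** * The wallpaper group p3 *)

Inductive p3_gen := GenX | GenY | GenRho.

Definition p3_rels : set (gterm p3_gen * gterm p3_gen) :=
  let x := Gen GenX in let y := Gen GenY in let rho := Gen GenRho in
  [set ([~ x, y], 1); (x ^ rho, x^-1 * y); (y ^ rho, x^-1); (rho ^+ 3, 1)].

Definition p3 : groupType := presented p3_rels.
Definition p3_x : p3 := pgen p3_rels GenX.
Definition p3_y : p3 := pgen p3_rels GenY.
Definition p3_rho : p3 := pgen p3_rels GenRho.

(** * The weak Cayley table group *)

Section WeakCayleyTable.
Variable G : groupType.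
Implicit Types (g h : G) (f : G -> G).

Definition conjugate g h : Prop := exists k, g ^ k = h.

Definition subgroup_generated (S : set G) : set G :=
  smallest (fun H : set G => group_closed (mem H)) S.

Definition perm_group (H : set (G -> G)) : Prop :=
  [/\ forall f, H f -> bijective f,
      H id,
      forall f1 f2, H f1 -> H f2 -> H (f1 \o f2) &
      forall f1 f2, H f1 -> cancel f1 f2 -> cancel f2 f1 -> H f2].

(* Meaningful when S consists of bijections; otherwise no group of
   permutations contains S and this is setT. *)
Definition perm_generated (S : set (G -> G)) : set (G -> G) :=
  smallest perm_group S.

Definition weak_cayley : set (G -> G) :=
  [set f | bijective f /\
           forall g1 g2, conjugate (f (g1 * g2)) (f g1 * f g2)].

Definition automorphisms : set (G -> G) :=
  [set f | bijective f /\ {morph f : g h / g * h}].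

Definition weak_cayley0 : set (G -> G) :=
  perm_generated (automorphisms `|` [set (fun g => g^-1)]).

End WeakCayleyTable.

Arguments weak_cayley : clear implicits.
Arguments automorphisms : clear implicits.
Arguments weak_cayley0 : clear implicits.

Definition p3_A : set p3 := subgroup_generated [set p3_x; p3_y].

Definition p3_tau (g : p3) : p3 :=
  if g \in [set a * p3_rho | a in p3_A] `|` [set a * p3_rho ^+ 2 | a in p3_A]
  then g ^ p3_rho else g.

(* Main.v *)
(* Write A as the lattice of Eisenstein integers, on which rho acts as a primitive
   cube root of unity w.  For a weak Cayley table map f, the composite of f with
   G -> G / A is a homomorphism; its kernel is A because classes outside A are
   infinite while those inside A have at most three elements.  On A conjugate
   elements have equal norm, so the norm of f(a) satisfies the parallelogram law
   and is w-invariant, hence is a multiple of the norm of a, and the multiple is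
   1 by surjectivity.  Thus f is an isometry of A fixing 0, so it is linear and
   extends to an automorphism of G; dividing by it, f is the identity on A.  Up to
   g |-> (n g)^-1, with n the automorphism inverting A and fixing rho, f also
   preserves the coset of rho.  The translation parts on that coset are again
   related by an isometry, a |-> b + w^j a, so f is the product of an automorphism
   (rho |-> rho b) and tau^j. *)
From HB Require Import structures.
Require Import Defs.
From mathcomp Require Import all_boot all_algebra.
From mathcomp Require Import boolp classical_sets.
From mathcomp Require Import zify.

Set Implicit Arguments.
Unset Strict Implicit.
Unset Printing Implicit Defensive.

Import GRing.Theory.

Local Open Scope classical_set_scope.
Local Open Scope group_scope.

(** * Homomorphisms of groups *)

Lemma morph_mulg1 (G H : groupType) (f : G -> H) :
  {morph f : g h / g * h} -> f 1 = 1.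
Proof. by move=> fM; apply: (@mulgI _ (f 1)); rewrite -fM !mulg1. Qed.

Lemma morph_mulgV (G H : groupType) (f : G -> H) :
  {morph f : g h / g * h} -> {morph f : g / g^-1}.
Proof.
by move=> fM g; apply: (@mulgI _ (f g)); rewrite -fM !mulgV morph_mulg1.
Qed.

Lemma morph_mulgX (G H : groupType) (f : G -> H) n :
  {morph f : g h / g * h} -> {morph f : g / g ^+ n}.
Proof.
by move=> fM g; elim: n => [|n IHn]; rewrite ?morph_mulg1 // !expgS fM IHn.
Qed.

Lemma morph_mulgJ (G H : groupType) (f : G -> H) :
  {morph f : g h / g * h} -> {morph f : g h / g ^ h}.
Proof. by move=> fM g h; rewrite /conjg !fM morph_mulgV. Qed.

(** * Presented groups and their universal property *)

Section Presentation.
Variables (I : Type) (R : set (gterm I * gterm I)).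

Lemma presented_piM t u :
  presented_pi R (t * u) = presented_pi R t * presented_pi R u.
Proof.
by apply/presented_piP/peq_sym/peq_mul; apply: peq_repr.
Qed.

Lemma presented_piV t : presented_pi R t^-1 = (presented_pi R t)^-1.
Proof. by apply/presented_piP/peq_sym/peq_inv; apply: peq_repr. Qed.

Lemma presented_piJ t u :
  presented_pi R (t ^ u) = presented_pi R t ^ presented_pi R u.
Proof. by rewrite /conjg !presented_piM presented_piV. Qed.

Lemma presented_pi1 : presented_pi R 1 = 1. Proof. by []. Qed.

Lemma presented_pi_rel l r : R (l, r) -> presented_pi R l = presented_pi R r.
Proof. by move=> Rlr; apply/presented_piP/peq_rel. Qed.

Lemma presented_hom_eq (G : groupType) (f g : presented R -> G) :
    {morph f : a b / a * b} -> {morph g : a b / a * b} ->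
  (forall i, f (pgen R i) = g (pgen R i)) -> f =1 g.
Proof.
move=> fM gM fg a; rewrite -(presented_reprK a).
elim: (repr a) => [i||t IHt u IHu|t IHt]; first exact: fg.
- by rewrite presented_pi1 !morph_mulg1.
- by rewrite presented_piM fM gM IHt IHu.
- by rewrite presented_piV !morph_mulgV // IHt.
Qed.

Variables (G : groupType) (phi : I -> G).

Fixpoint gterm_eval (t : gterm I) : G :=
  match t with
  | Gen i => phi i
  | One => 1
  | Mul t u => gterm_eval t * gterm_eval u
  | Inv t => (gterm_eval t)^-1
  end.

(** Evaluation at a chosen representative; it is independent of that choice once [phi] respects the
    relations. *)
Definition presented_lift (a : presented R) : G := gterm_eval (repr a).

Hypothesis phi_rel : forall l r, R (l, r) -> gterm_eval l = gterm_eval r.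

Lemma gterm_eval_peq t u : peq R t u -> gterm_eval t = gterm_eval u.
Proof.
elim=> //= {t u}.
- by move=> t u v _ -> _ ->.
- by move=> t t' u u' _ -> _ ->.
- by move=> t t' _ ->.
- by move=> *; rewrite mulgA.
- by move=> *; rewrite mul1g.
- by move=> *; rewrite mulg1.
- by move=> *; rewrite mulVg.
- by move=> *; rewrite mulgV.
Qed.

Lemma presented_lift_pi t : presented_lift (presented_pi R t) = gterm_eval t.
Proof. exact/gterm_eval_peq/peq_repr. Qed.

Lemma presented_liftM : {morph presented_lift : a b / a * b}.
Proof. by move=> a b; rewrite [LHS]presented_lift_pi. Qed.

Lemma presented_lift_gen i : presented_lift (pgen R i) = phi i.
Proof. exact: presented_lift_pi. Qed.

End Presentation.

(** * Powers with integer exponents *)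

Section IntPower.
Variable G : groupType.
Implicit Types (g h : G) (m n : int).

Definition expgz g m : G :=
  match m with Posz k => g ^+ k | Negz k => g ^- k.+1 end.

Lemma expgzS g m : expgz g (m + 1)%R = expgz g m * g.
Proof.
case: m => [k|[|k]].
- have -> : (Posz k + 1)%R = Posz k.+1 by lia.
  exact: expgSr.
- by rewrite [RHS]mulVg.
- have -> : (Negz k.+1 + 1)%R = Negz k by lia.
  by rewrite /= [in RHS]expgS invgM mulgVK.
Qed.

Lemma expgzD g m n : expgz g (m + n)%R = expgz g m * expgz g n.
Proof.
elim/int_rect: n => [|k IHk|k IHk]; first by rewrite addr0 mulg1.
  have -> : (k.+1%:Z = k%:Z + 1)%R by lia.
  by rewrite addrA !expgzS IHk mulgA.
apply: (@mulIg _ g); rewrite -mulgA -!expgzS.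
have -> : (m - k.+1%:Z + 1 = m - k%:Z)%R by lia.
by have -> : (- k.+1%:Z + 1 = - k%:Z)%R by lia.
Qed.

Lemma commute_expgz g h m : commute g h -> commute g (expgz h m).
Proof.
by case: m => k gh; [|apply: commuteV]; apply: commuteX.
Qed.

Lemma expgzN g m : expgz g (- m)%R = (expgz g m)^-1.
Proof. by apply/esym/mulg1_eq; rewrite -expgzD subrr. Qed.

Lemma expVgz g m : expgz g^-1 m = expgz g (- m)%R.
Proof.
by rewrite expgzN; case: m => k; rewrite /= expVgn.
Qed.

Lemma expgzMn g h m : commute g h -> expgz (g * h) m = expgz g m * expgz h m.
Proof.
move=> gh; case: m => k /=; rewrite expgMn // invgM.
by apply/commute_sym/commuteV/commute_sym/commuteV/commuteX2.
Qed.

Lemma conjXgz g h m : expgz g m ^ h = expgz (g ^ h) m.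
Proof. by case: m => k /=; rewrite ?conjVg conjXg. Qed.

End IntPower.

Lemma morph_expgz (G H : groupType) (f : G -> H) m :
  {morph f : g h / g * h} -> {morph f : g / expgz g m}.
Proof.
by move=> fM g; case: m => k; rewrite /expgz ?(morph_mulgV fM) (morph_mulgX _ fM).
Qed.

(** * Conjugacy and weak Cayley table maps *)

Section Conjugacy.
Variable G : groupType.
Implicit Types (g h k : G) (f : G -> G).

Lemma conjugate_refl g : conjugate g g.
Proof. by exists 1; rewrite conjg1. Qed.

Lemma conjugate_sym g h : conjugate g h -> conjugate h g.
Proof. by move=> [k <-]; exists k^-1; rewrite conjgK. Qed.

Lemma conjugate_trans g h k : conjugate g h -> conjugate h k -> conjugate g k.
Proof. by move=> [a <-] [b <-]; exists (a * b); rewrite conjgM. Qed.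

Lemma conjugate_mulC g h : conjugate (g * h) (h * g).
Proof. by exists g; rewrite /conjg -mulgA mulKg. Qed.

Lemma conjugate1 g : conjugate 1 g -> g = 1.
Proof. by move=> [k <-]; rewrite conj1g. Qed.

Variable f : G -> G.
Hypothesis fW : weak_cayley G f.

Lemma weak_cayley1 : f 1 = 1.
Proof.
case: fW => -[f' _ f'K] fM.
(* The second factor is the preimage of [(f 1)^-1], so the right-hand side collapses to [1]. *)
have := fM 1 (f' (f 1)^-1); rewrite mul1g f'K mulgV.
by move=> /conjugate_sym/conjugate1/esym/eqP; rewrite eq_sym invg_eq1 => /eqP.
Qed.

Lemma weak_cayleyV g : f g^-1 = (f g)^-1.
Proof.
have := fW.2 g g^-1; rewrite mulgV weak_cayley1 => /conjugate1 e.
by rewrite (mulg1_eq e).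
Qed.

(** Up to conjugacy, the factors of [k^-1 * (g * k)] may be swapped after applying [f], and
    [g * k * k^-1] is [g]. *)
Lemma weak_cayleyJ g h : conjugate g h -> conjugate (f g) (f h).
Proof.
move=> [k <-]; rewrite /conjg.
apply: conjugate_sym; apply: conjugate_trans (fW.2 _ _) _.
apply: conjugate_trans (conjugate_mulC _ _) _.
apply: conjugate_trans (conjugate_sym (fW.2 _ _)) _.
by rewrite mulgK; apply: conjugate_refl.
Qed.

End Conjugacy.

Lemma weak_cayley_comp (G : groupType) (f1 f2 : G -> G) :
  weak_cayley G f1 -> weak_cayley G f2 -> weak_cayley G (f1 \o f2).
Proof.
move=> W1 W2; split; first exact: bij_comp W1.1 W2.1.
move=> g h; apply: (conjugate_trans _ (W1.2 _ _)).
exact: (weak_cayleyJ W1 (W2.2 g h)).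
Qed.

Lemma automorphism_weak_cayley (G : groupType) (f : G -> G) :
  automorphisms G f -> weak_cayley G f.
Proof.
by move=> [fB fM]; split=> // g h; rewrite fM; apply: conjugate_refl.
Qed.

Lemma inv_weak_cayley (G : groupType) : weak_cayley G (fun g => g^-1).
Proof.
split=> [|g h]; first by exists (fun g : G => g^-1); apply: invgK.
by rewrite invgM; apply: conjugate_mulC.
Qed.

Lemma automorphism_can (G : groupType) (f f' : G -> G) :
  automorphisms G f -> cancel f f' -> cancel f' f -> automorphisms G f'.
Proof.
move=> [_ fM] fK f'K; split; first by exists f.
by move=> g h; apply: (can_inj fK); rewrite fM !f'K.
Qed.

(* The inverse of a weak Cayley table map need not obviously be one, so
   invertibility is part of the definition of this set. *)
Definition weak_cayley_unit (G : groupType) : set (G -> G) :=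
  [set f | weak_cayley G f /\
           exists f', [/\ weak_cayley G f', cancel f f' & cancel f' f]].

Lemma perm_group_weak_cayley_unit (G : groupType) :
  perm_group (@weak_cayley_unit G).
Proof.
have W1 : weak_cayley G id.
  by split=> [|g h]; [exists id | apply: conjugate_refl].
split.
- by move=> f [[]].
- by split=> //; exists id.
- move=> f1 f2 [W1' [f1' [V1 K1 K1']]] [W2 [f2' [V2 K2 K2']]].
  split; first exact: weak_cayley_comp.
  by exists (f2' \o f1'); split;
    [apply: weak_cayley_comp | apply: can_comp | apply: can_comp].
- move=> f1 f2 [Wf [f1' [V1 K1 K1']]] K2 K2'.
  have -> : f2 = f1' by apply/funext=> g; rewrite -[in RHS](K2' g) K1.
  by split=> //; exists f1.
Qed.

Lemma automorphisms_weak_cayley_unit (G : groupType) :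
  automorphisms G `<=` @weak_cayley_unit G.
Proof.
move=> f fA; split; first exact: automorphism_weak_cayley.
have [f' K K'] := fA.1.
exists f'; split=> //.
exact/automorphism_weak_cayley/(automorphism_can fA).
Qed.

Lemma inv_weak_cayley_unit (G : groupType) :
  @weak_cayley_unit G (fun g => g^-1).
Proof.
split; first exact: inv_weak_cayley.
by exists (fun g => g^-1); split; [apply: inv_weak_cayley | |]; apply: invgK.
Qed.

(** * The Eisenstein lattice and its isometries *)

Section Eisenstein.
Local Open Scope ring_scope.

Definition eis : Type := (int * int)%type.
HB.instance Definition _ := GRing.Zmodule.on eis.

Implicit Types (a b u v : eis).

(* The pair (m, n) stands for x ^ m * y ^ n, that is, for the Eisenstein integer
   m + n (1 + w), where w is a primitive cube root of unity. *)
Definition omega a : eis := (- a.1 - a.2, a.1).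

(** The squared modulus of m + n (1 + w), as 1 + w is a primitive sixth root of unity. *)
Definition enorm a : int := a.1 * a.1 + a.1 * a.2 + a.2 * a.2.

Definition eis_rot (i : 'Z_3) a : eis := iter i omega a.

Lemma eisP a b : a.1 = b.1 -> a.2 = b.2 -> a = b.
Proof. by case: a b => [a1 a2] [b1 b2] /= -> ->. Qed.

Lemma eisD1 a b : (a + b).1 = a.1 + b.1. Proof. by []. Qed.
Lemma eisD2 a b : (a + b).2 = a.2 + b.2. Proof. by []. Qed.
Lemma eisN1 a : (- a).1 = - a.1. Proof. by []. Qed.
Lemma eisN2 a : (- a).2 = - a.2. Proof. by []. Qed.
Lemma eis01 : (0 : eis).1 = 0. Proof. by []. Qed.
Lemma eis02 : (0 : eis).2 = 0. Proof. by []. Qed.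
Definition eisE := (eisD1, eisD2, eisN1, eisN2, eis01, eis02).

Lemma Z3_ind (P : 'Z_3 -> Prop) : P 0 -> P 1 -> P (-1) -> forall i, P i.
Proof.
move=> P0 P1 P2 [[|[|[|//]]] lti]; [move: P0|move: P1|move: P2];
  by congr (P _); apply: val_inj.
Qed.

Lemma eis_rot0 a : eis_rot 0 a = a. Proof. by []. Qed.
Lemma eis_rot1 a : eis_rot 1 a = omega a. Proof. by []. Qed.
Lemma eis_rotN1 a : eis_rot (-1) a = omega (omega a). Proof. by []. Qed.
Definition eis_rotE := (eis_rot0, eis_rot1, eis_rotN1).

Lemma omega3 a : omega (omega (omega a)) = a.
Proof. by apply: eisP; rewrite /=; lia. Qed.

Lemma iter_omega_mod n a : iter (n %% 3) omega a = iter n omega a.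
Proof.
rewrite {2}(divn_eq n 3) addnC iterD; congr (iter _ _ _).
by elim: (n %/ 3)%N => // k IHk; rewrite mulSn iterD -IHk /= omega3.
Qed.

Lemma eis_rotD i j a : eis_rot (i + j) a = eis_rot i (eis_rot j a).
(* The sum in ['Z_3] is a sum of naturals reduced mod 3, which does not affect the iterate. *)
Proof. by rewrite /eis_rot -iterD -[RHS]iter_omega_mod. Qed.

Lemma eis_rot_is_additive i : zmod_morphism (eis_rot i).
Proof.
by move=> a b; elim/Z3_ind: i; rewrite ?eis_rotE; apply: eisP; rewrite /= ?eisE; lia.
Qed.

HB.instance Definition _ i :=
  GRing.isZmodMorphism.Build eis eis (eis_rot i) (eis_rot_is_additive i).

Lemma enorm_rot i a : enorm (eis_rot i a) = enorm a.
Proof. by elim/Z3_ind: i; rewrite ?eis_rotE /enorm /=; lia. Qed.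

Lemma enorm_ge0 a : (0 <= enorm a)%R.
Proof. by rewrite /enorm; nia. Qed.

Lemma enorm10 : enorm (1, 0) = 1. Proof. by []. Qed.

(** The additive map with [u] and [v] as images of the basis vectors. *)
Definition lin u v a : eis :=
  (a.1 * u.1 + a.2 * v.1, a.1 * u.2 + a.2 * v.2).

(** The six units. The coordinates are bounded because 4 (m^2 + m n + n^2) = (2 m + n)^2 + 3 n^2,
    and symmetrically in m. *)
Lemma enorm1_cases u : enorm u = 1 ->
  [\/ u = (1, 0) \/ u = (-1, 0), u = (0, 1) \/ u = (0, -1)
    | u = (1, -1) \/ u = (-1, 1)].
Proof.
case: u => m n; rewrite /enorm /= => mn1.
have hm : -1 <= m <= 1 by nia.
have hn : -1 <= n <= 1 by nia.
have {hm} : m = -1 \/ m = 0 \/ m = 1 by lia.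
have {hn} : n = -1 \/ n = 0 \/ n = 1 by lia.
by move=> [m1|[m1|m1]] [n1|[n1|n1]]; rewrite m1 n1 in mn1 *;
  solve [constructor 1; auto | constructor 2; auto | constructor 3; auto
        | exfalso; lia].
Qed.

(** The images [u], [v] of the basis are units at distance 1, so [v] is u (1 + w) or u (1 + w^2); a
    point is then determined by its distances to 0, [u] and [v]. *)
Lemma isometry_lin (f : eis -> eis) : f 0 = 0 ->
    (forall a b, enorm (f a - f b) = enorm (a - b)) ->
  exists u e, [/\ enorm u = 1, e = 1 \/ e = -1 & f =1 lin u (u + eis_rot e u)].
Proof.
move=> f0 fiso; set u := f (1, 0); set v := f (0, 1).
have u1 : enorm u = 1 by have := fiso (1, 0) 0; rewrite f0 !subr0.
have v1 : enorm v = 1 by have := fiso (0, 1) 0; rewrite f0 !subr0.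
have uv1 : enorm (u - v) = 1 by rewrite fiso.
have fN a : [/\ enorm (f a) = enorm a, enorm (f a - u) = enorm (a - (1, 0))
                & enorm (f a - v) = enorm (a - (0, 1))].
  by split; rewrite ?fiso // -[f a]subr0 -[in LHS]f0 fiso subr0.
have [e e1 ve] : exists2 e, e = 1 \/ e = -1 & v = u + eis_rot e u.
  move: uv1; case: (enorm1_cases u1) => -[->|->];
    case: (enorm1_cases v1) => -[->|->] // _;
    by [exists 1; first left | exists (-1); first right].
exists u, e; split=> // a; rewrite -ve.
have [] := fN a; move: uv1; rewrite /lin /enorm !eisE {ve}.
(* Differences of the three norm equations lose their quadratic terms, leaving a linear system for
   the coordinates of [f a]. *)
by case: (enorm1_cases u1) => -[->|->];
  case: (enorm1_cases v1) => -[->|->] //= _ N1 N2 N3; apply: eisP => /=; lia.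
Qed.

Lemma lin_is_additive u v : zmod_morphism (lin u v).
Proof. by move=> a b; apply: eisP; rewrite /= ?eisE /=; lia. Qed.

HB.instance Definition _ u v :=
  GRing.isZmodMorphism.Build eis eis (lin u v) (lin_is_additive u v).

(** The map is a |-> u a for [e = 1], and a |-> u conj(a) for [e = -1]; complex conjugation inverts
    w. *)
Lemma lin_rot u e i a : e = 1 \/ e = -1 ->
  lin u (u + eis_rot e u) (eis_rot i a) =
  eis_rot (e * i) (lin u (u + eis_rot e u) a).
Proof.
move=> [|] ->; rewrite ?mul1r ?mulN1r; elim/Z3_ind: i;
  rewrite ?oppr0 ?opprK ?eis_rotE //; apply: eisP; rewrite /= ?eisE /=; lia.
Qed.

Lemma lin_bij u e : enorm u = 1 -> e = 1 \/ e = -1 ->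
  bijective (lin u (u + eis_rot e u)).
Proof.
move=> u1 [|] ->; rewrite eis_rotE.
  (* The inverse of multiplication by a unit is multiplication by its complex conjugate. *)
  by exists (lin (u.1 + u.2, - u.2) (u.2, u.1)) => a;
    case: (enorm1_cases u1) => -[->|->]; apply: eisP; rewrite /= ?eisE /=; lia.
(* The map a |-> u conj(a) is an involution, so it is its own inverse. *)
by exists (lin u (u.1 + u.2, - u.1)) => a;
  case: (enorm1_cases u1) => -[->|->]; apply: eisP; rewrite /= ?eisE /=; lia.
Qed.

Lemma lin_pointwise_rot u v :
  (forall a, exists i, lin u v a = eis_rot i a) ->
  exists j, lin u v =1 eis_rot j.
Proof.
have lx : lin u v (1, 0) = u by apply: eisP => /=; lia.
have ly : lin u v (0, 1) = v by apply: eisP => /=; lia.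
move=> uv; have [i] := uv (1, 0); have [j] := uv (0, 1).
(* This third point excludes different rotations of the two basis vectors: their sum would not be a
   rotation of [(1, 1)]. *)
have [k] := uv (1, 1); rewrite lx ly => kE vE uE.
exists i => a; have [ij|ij] := eqVneq i j.
  rewrite uE vE -ij; elim/Z3_ind: i {uE ij};
    apply: eisP; rewrite /= ?eis_rot0 /=; lia.
exfalso; move: ij kE; rewrite uE vE.
elim/Z3_ind: i {uE}; elim/Z3_ind: j {vE}; elim/Z3_ind: k;
  by rewrite ?eqxx // => _ [].
Qed.

(** Second differences vanish, so two consecutive zeros propagate in both directions. *)
Lemma affine_recurrence_eq0 (h : int -> int) :
  (forall k, h (k + 1) + h (k - 1) = 2 * h k) -> h 0 = 0 -> h 1 = 0 ->
  forall k, h k = 0.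
Proof.
move=> hrec h0 h1.
have pos (n : nat) : h n%:Z = 0 /\ h (n%:Z + 1) = 0.
  elim: n => // n [IH1 IH2]; have -> : n.+1%:Z = n%:Z + 1 by lia.
  by split=> //; have := hrec (n%:Z + 1); rewrite addrK IH1 IH2 addr0 mulr0.
have neg (n : nat) : h (- n%:Z) = 0 /\ h (- n%:Z + 1) = 0.
  elim: n => [|n [IH1 IH2]]; first by rewrite oppr0 add0r.
  have -> : - n.+1%:Z = - n%:Z - 1 by lia.
  by rewrite subrK; split=> //; have := hrec (- n%:Z); rewrite IH1 IH2 add0r mulr0.
by case=> n; [case: (pos n) | rewrite NegzE; case: (neg n.+1)].
Qed.

(** The defect [d] inherits both hypotheses and vanishes at [(1, 0)], hence at all units. Along a
    line whose direction is a unit its second differences vanish, which spreads the zeros over the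
    lattice. *)
Lemma parallelogram_enorm (q : eis -> int) :
    (forall a b, q (a + b) + q (a - b) = 2 * q a + 2 * q b) ->
    (forall i a, q (eis_rot i a) = q a) ->
  forall a, q a = q (1, 0) * enorm a.
Proof.
move=> qpar qrot; set c := q (1, 0).
pose d a := q a - c * enorm a.
have dpar a b : d (a + b) + d (a - b) = 2 * d a + 2 * d b.
  by have := qpar a b; rewrite /d /enorm !eisE; lia.
have d0 : d 0 = 0.
  have e : d 0 + d 0 = 2 * d 0 + 2 * d 0 := dpar 0 0.
  by lia.
have drot i a : d (eis_rot i a) = d a by rewrite /d qrot enorm_rot.
have dN a : d (- a) = d a.
  by have := dpar 0 a; rewrite add0r sub0r d0 mulr0 add0r mulr_natl mulr2n => /addrI.
have dx : d (1, 0) = 0 by rewrite /d enorm10 mulr1 subrr.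
have dy : d (0, 1) = 0 by rewrite -[d _](drot 1) -dN.
have dxy : d (1, -1) = 0 by rewrite -[d _]dN -(drot (-1)).
have d0n n : d (0, n) = 0.
  apply: (affine_recurrence_eq0 (h := fun n => d (0, n))) => // k.
  by have := dpar (0, k) (0, 1); rewrite dy mulr0 addr0.
have d1n n : d (1, n) = 0.
  (* The shift starts the recurrence at the known zeros [(1, -1)] and [(1, 0)]. *)
  rewrite -(addrK 1 n).
  apply: (affine_recurrence_eq0 (h := fun n => d (1, n - 1))) => // k.
  by have := dpar (1, k - 1) (0, 1); rewrite dy mulr0 addr0 => <-;
    congr (d _ + d _); apply: eisP; rewrite /= ?eisE; lia.
have dmn m n : d (m, n) = 0.
  apply: (affine_recurrence_eq0 (h := fun m => d (m, n))) => // k.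
  by have := dpar (k, n) (1, 0); rewrite dx mulr0 addr0 => <-;
    congr (d _ + d _); apply: eisP; rewrite /= ?eisE; lia.
by case=> m n; have := dmn m n; rewrite /d; lia.
Qed.

End Eisenstein.

(* The element (i, a) stands for rho ^ i * a. *)
Definition p3_model : Type := ('Z_3 * eis)%type.
HB.instance Definition _ := Choice.on p3_model.

(** * The semidirect product of the lattice by the rotations *)

Section ModelGroup.
Local Open Scope ring_scope.
Implicit Types (g h : p3_model).

(** Moving a translation to the right past [rho ^ j] conjugates it by [rho ^ j], which rotates
    it. *)
Definition p3_model_mul g h : p3_model := (g.1 + h.1, eis_rot h.1 g.2 + h.2).
Definition p3_model_one : p3_model := (0, 0).
Definition p3_model_inv g : p3_model := (- g.1, - eis_rot (- g.1) g.2).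

Lemma p3_model_mulA : associative p3_model_mul.
Proof.
move=> [i a] [j b] [k c].
rewrite /p3_model_mul /=; congr pair; first exact: addrA.
by rewrite raddfD /= -addrA [j + k]addrC eis_rotD.
Qed.

Lemma p3_model_mul1g : left_id p3_model_one p3_model_mul.
Proof. by move=> [i a]; rewrite /p3_model_mul /= raddf0 !add0r. Qed.

Lemma p3_model_mulg1 : right_id p3_model_one p3_model_mul.
Proof. by move=> [i a]; rewrite /p3_model_mul /= eis_rot0 !addr0. Qed.

Lemma p3_model_mulVg :
  left_inverse p3_model_one p3_model_inv p3_model_mul.
Proof.
by move=> [i a]; rewrite /p3_model_mul /= raddfN /= -eis_rotD subrr eis_rot0 !addNr.
Qed.

Lemma p3_model_mulgV :
  right_inverse p3_model_one p3_model_inv p3_model_mul.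
Proof. by move=> [i a]; rewrite /p3_model_mul /= !subrr. Qed.

End ModelGroup.

HB.instance Definition _ := isGroup.Build p3_model
  p3_model_mulA p3_model_mul1g p3_model_mulg1
  p3_model_mulVg p3_model_mulgV.

(** * Conjugacy classes of the model and the twist *)

Section ModelTheory.
Local Open Scope ring_scope.
Implicit Types (g h : p3_model) (i j : 'Z_3) (a b : eis).

Lemma p3_modelM i a j b :
  (((i, a) : p3_model) * ((j, b) : p3_model))%g = (i + j, eis_rot j a + b).
Proof. by []. Qed.

Lemma p3_modelV i a : ((i, a) : p3_model)^-1%g = (- i, - eis_rot (- i) a).
Proof. by []. Qed.

Lemma p3_modelJ i a j b :
  (((i, a) : p3_model) ^ ((j, b) : p3_model))%g = (i, eis_rot j a + b - eis_rot i b).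
Proof.
rewrite /conjg p3_modelV !p3_modelM addrC addrK; congr pair.
by rewrite raddfN /= -eis_rotD addrK addrC.
Qed.

Lemma conjugate_model1 g h : conjugate g h -> g.1 = h.1.
Proof. by case: g => i a [[j b] <-]; rewrite p3_modelJ. Qed.

Lemma conjugate_model0 a b :
  conjugate ((0, a) : p3_model) (0, b) <-> exists i, b = eis_rot i a.
Proof.
split=> [[[i c]]|[i ->]].
  by rewrite p3_modelJ eis_rot0 addrK => -[<-]; exists i.
by exists (i, 0); rewrite p3_modelJ eis_rot0 addrK.
Qed.

(** Conjugation by a translation e adds (1 - w^i) e; for [i] nonzero, 1 - w^i divides w^k - 1. *)
Lemma conjugate_model_coset i k a c :
  i != 0 -> conjugate ((i, a) : p3_model) (i, a + (eis_rot k c - c)).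
Proof.
move=> i0; suff [e ec] : exists e, e - eis_rot i e = eis_rot k c - c.
  by exists (0, e); rewrite p3_modelJ eis_rot0 -addrA ec.
have [->|k0] := eqVneq k 0; first by exists 0; rewrite raddf0 !subrr.
have [->|ik] := eqVneq i k.
  by exists (- c); rewrite raddfN opprK addrC.
move: i0 k0 ik; elim/Z3_ind: i; elim/Z3_ind: k; rewrite ?eqxx // => _ _ _.
  by exists (omega (omega c)); rewrite eis_rot1 omega3.
by exists (omega c); rewrite !eis_rotN1 omega3.
Qed.

(** Off the lattice this is conjugation by [rho ^ k]; treating all powers of the twist together
    gives inverses of the same form. *)
Definition p3_model_tau k g : p3_model :=
  if g.1 == 0 then g else (g.1, eis_rot k g.2).

Lemma p3_model_tauD k l g :
  p3_model_tau (k + l) g = p3_model_tau k (p3_model_tau l g).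
Proof.
by rewrite /p3_model_tau; case: (eqVneq g.1 0) => [->|/negPf g0];
  rewrite ?eqxx //= g0 eis_rotD.
Qed.

Lemma p3_model_tau0 g : p3_model_tau 0 g = g.
Proof. by case: g => i a; rewrite /p3_model_tau /=; case: ifP. Qed.

Lemma p3_model_tauK k : cancel (p3_model_tau k) (p3_model_tau (- k)).
Proof. by move=> g; rewrite -p3_model_tauD addNr p3_model_tau0. Qed.

Lemma p3_model_tauNK k : cancel (p3_model_tau (- k)) (p3_model_tau k).
Proof. by move=> g; rewrite -p3_model_tauD subrr p3_model_tau0. Qed.

(** If exactly one factor lies in the lattice, the two sides differ by some w^k c - c, which
    [conjugate_model_coset] absorbs. If neither does, the product of the images is the product
    rotated by w^k. *)
Lemma p3_model_tau_weak_cayley k : weak_cayley p3_model (p3_model_tau k).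
Proof.
split; first exact: Bijective (p3_model_tauK k) (p3_model_tauNK k).
have rotC i a : eis_rot k (eis_rot i a) = eis_rot i (eis_rot k a).
  by rewrite -!eis_rotD addrC.
case=> i a [j b]; rewrite /p3_model_tau /=.
have [->|i0] := eqVneq i 0; have [->|j0] := eqVneq j 0;
  rewrite !p3_modelM ?add0r ?addr0 /= ?eqxx ?(negPf i0) ?(negPf j0).
- exact: conjugate_refl.
- rewrite raddfD /=; apply: conjugate_sym.
  have := @conjugate_model_coset j k (eis_rot j a + eis_rot k b) (eis_rot j a) j0.
  by rewrite [_ + (_ - _)]addrC addrA subrK.
- rewrite raddfD /=; apply: conjugate_sym.
  have := @conjugate_model_coset i k (eis_rot k a + b) b i0.
  by rewrite -addrA [b + _]addrC subrK.
rewrite -rotC -raddfD /=; have [->|_] := eqVneq (i + j) 0.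
  by apply/conjugate_model0; exists k.
exact: conjugate_refl.
Qed.

Lemma p3_model_tau_weak_cayley_unit k :
  @weak_cayley_unit p3_model (p3_model_tau k).
Proof.
split; first exact: p3_model_tau_weak_cayley.
exists (p3_model_tau (- k)); split; first exact: p3_model_tau_weak_cayley.
  exact: p3_model_tauK.
exact: p3_model_tauNK.
Qed.

End ModelTheory.

(** * Automorphisms from lattice isometries and from cocycles *)

Section ModelAutomorphisms.
Local Open Scope ring_scope.

Lemma lin_automorphism u (e : 'Z_3) : enorm u = 1 -> e = 1 \/ e = -1 ->
  automorphisms p3_model
    (fun g => (e * g.1, lin u (u + eis_rot e u) g.2) : p3_model).
Proof.
move=> u1 e1; have [l linK lK] := lin_bij u1 e1.
have ee : e * e = 1 by case: e1 => ->; rewrite ?mulr1 ?mulrNN ?mulr1.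
split.
  exists (fun g => (e * g.1, l g.2) : p3_model) => -[i a] /=.
    by rewrite mulrA ee mul1r linK.
  by rewrite mulrA ee mul1r lK.
move=> [i a] [j b]; rewrite !p3_modelM /= mulrDr; congr pair.
by rewrite raddfD /= lin_rot.
Qed.

(* A derivation from the rotation group to the translation lattice; it sends
   the rotation by w to b. *)
Definition p3_cocycle b (i : 'Z_3) : eis :=
  if i == 0 then 0 else if i == 1 then b else - eis_rot (-1) b.

Lemma p3_cocycleD b i j :
  p3_cocycle b (i + j) = eis_rot j (p3_cocycle b i) + p3_cocycle b j.
Proof.
by elim/Z3_ind: i; elim/Z3_ind: j; apply: eisP;
  rewrite /p3_cocycle /= ?eis_rot0 ?eisE /=; lia.
Qed.

Lemma p3_cocycleN b i : p3_cocycle (- b) i = - p3_cocycle b i.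
Proof. by elim/Z3_ind: i; rewrite /p3_cocycle /= ?raddfN ?oppr0. Qed.

(** It fixes the lattice and sends rho to rho b; multiplicativity is the cocycle identity. *)
Lemma cocycle_automorphism b :
  automorphisms p3_model (fun g => (g.1, g.2 + p3_cocycle b g.1) : p3_model).
Proof.
split.
  by exists (fun g => (g.1, g.2 + p3_cocycle (- b) g.1)) => -[i a] /=;
    rewrite p3_cocycleN ?addrK ?subrK.
move=> [i a] [j c]; rewrite !p3_modelM /= p3_cocycleD raddfD /=.
by congr pair; rewrite addrACA.
Qed.

End ModelAutomorphisms.

(** * Rigidity of weak Cayley table maps on the model *)

Section WeakCayleyModel.
Local Open Scope ring_scope.
Variable F : p3_model -> p3_model.
Hypothesis FW : weak_cayley p3_model F.
Implicit Types (i j k : 'Z_3) (a b c : eis).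

Lemma weak_cayley_model1M g h : (F (g * h)%g).1 = (F g).1 + (F h).1.
Proof. exact: conjugate_model1 (FW.2 g h). Qed.

(* Conjugacy classes are infinite outside the lattice but have at most three
   elements inside it. *)
Lemma weak_cayley_model1_neq0 i a : i != 0 -> (F (i, a)).1 != 0.
Proof.
move=> i0; apply/eqP => Fi0.
(* The [g n] are conjugates of [(i, a)] by translations, distinct since [i] is nonzero. *)
pose c n : eis := (n%:Z, 0); pose g n : p3_model := (i, a + c n - eis_rot i (c n)).
have Fg n : exists k, F (g n) = (0, eis_rot k (F (i, a)).2).
  have : conjugate (F (i, a)) (F (g n)).
    by apply: weak_cayleyJ => //; exists (0, c n); rewrite p3_modelJ eis_rot0.
  move: Fi0; case: (F (i, a)) (F (g n)) => _ b [j d] /= -> C.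
  have /= jE := conjugate_model1 C; rewrite -jE in C *.
  by have [k ->] := (conjugate_model0 _ _).1 C; exists k.
have [k hk] := choice Fg.
(* Four conjugates suffice: by injectivity of [F] they would need four distinct rotations in
   ['Z_3]. *)
have k_inj : injective (fun n : 'I_4 => k n).
  move=> m n kmn; apply: val_inj.
  have : g m = g n by apply: (bij_inj FW.1); rewrite !hk kmn.
  move=> -[]; move: i0; rewrite /c.
  by elim/Z3_ind: i {Fi0 g Fg k hk kmn}; rewrite ?eqxx ?eis_rotE /= ?eisE /=; lia.
by have := leq_card _ k_inj; rewrite !card_ord.
Qed.

(** With s and t the rotation parts of [F (1, 0)] and [F (0, a)], the elements s, s + t, s + 2 t are
    nonzero; were t nonzero, they would exhaust ['Z_3]. *)
Lemma weak_cayley_model1_eq0 a : (F (0, a)).1 = 0.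
Proof.
have h1 := weak_cayley_model1_neq0 0 (isT : (1 : 'Z_3) != 0).
have h2 := weak_cayley_model1_neq0 a (isT : (1 : 'Z_3) != 0).
have h3 := weak_cayley_model1_neq0 (a + a) (isT : (1 : 'Z_3) != 0).
have e2 : (F (1, a)).1 = (F (1, 0)).1 + (F (0, a)).1.
  by rewrite -weak_cayley_model1M p3_modelM addr0 eis_rot0 add0r.
have e3 : (F (1, a + a)).1 = (F (1, 0)).1 + ((F (0, a)).1 + (F (0, a)).1).
  by rewrite -!weak_cayley_model1M !p3_modelM !addr0 !eis_rot0 add0r.
move: h1 h2 h3; rewrite e2 e3.
by elim/Z3_ind: (F (0, a)).1; elim/Z3_ind: (F (1, 0)).1.
Qed.

Let f a : eis := (F (0, a)).2.

Let FE a : F (0, a) = (0, f a).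
Proof. by rewrite [LHS]surjective_pairing weak_cayley_model1_eq0. Qed.

Lemma weak_cayley_model_isometry :
  f 0 = 0 /\ forall a b, enorm (f a - f b) = enorm (a - b).
Proof.
have f0 : f 0 = 0 by rewrite /f (weak_cayley1 FW).
have fD a b : enorm (f (a + b)) = enorm (f a + f b).
  have := FW.2 (0, a) (0, b); rewrite !FE !p3_modelM !eis_rot0 addr0 FE.
  by move=> /conjugate_model0[k ->]; rewrite enorm_rot.
have fN a : f (- a) = - f a.
  have := weak_cayleyV FW (0, a); rewrite FE !p3_modelV oppr0 !eis_rot0 FE.
  by case.
have fB a b : enorm (f a - f b) = enorm (f (a - b)) by rewrite fD fN.
have frot i a : enorm (f (eis_rot i a)) = enorm (f a).
  have : conjugate ((0, a) : p3_model) (0, eis_rot i a).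
    by apply/conjugate_model0; exists i.
  move=> /(weak_cayleyJ FW); rewrite !FE => /conjugate_model0[k ->].
  by rewrite enorm_rot.
have fpar a b : enorm (f (a + b)) + enorm (f (a - b))
              = 2 * enorm (f a) + 2 * enorm (f b).
  by rewrite fD -fB /enorm !eisE; lia.
have fnorm := parallelogram_enorm fpar frot.
(* The preimage lies in the lattice because [F] maps its complement to its complement. Then 1 is the
   scale factor times the norm of [c], a product of nonnegative integers, so the factor is 1. *)
have [c fc] : exists c, f c = (1, 0).
  have [F' FK F'K] := FW.1; case E : (F' (0, (1, 0))) => [i c].
  have FEc : F (i, c) = (0, (1, 0)) by rewrite -E F'K.
  exists c; rewrite /f; have [<-|i0] := eqVneq i 0; first by rewrite FEc.
  by have := weak_cayley_model1_neq0 c i0; rewrite FEc.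
have f1 : enorm (f (1, 0)) = 1.
  have := fnorm c; rewrite fc enorm10.
  have := enorm_ge0 c; have := enorm_ge0 (f (1, 0)).
  move: (enorm c) (enorm _) => p q q0 p0 qp1.
  have [p0'|p1] : p = 0 \/ 0 < p by lia.
    by rewrite p0' mulr0 in qp1.
  have [q0'|q1] : q = 0 \/ 0 < q by lia.
    by rewrite q0' mul0r in qp1.
  by nia.
by split=> // a b; rewrite fB fnorm f1 mul1r.
Qed.

Hypothesis F0 : forall a, F (0, a) = (0, a).
Hypothesis F1 : (F (1, 0)).1 = 1.

Lemma weak_cayley_model_normal_form : exists b j,
  forall g, F g = ((p3_model_tau j g).1,
                   (p3_model_tau j g).2 + p3_cocycle b (p3_model_tau j g).1).
Proof.
pose p a := (F (1, a)).2.
have F1E a : F (1, a) = (1, p a).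
  have := weak_cayley_model1M (1, 0) (0, a).
  rewrite p3_modelM F1 F0 /= !addr0 add0r => e.
  by rewrite [LHS]surjective_pairing e.
(* The product of [(1, a)^-1] and [(1, b)] is the translation [b - a], which [F] fixes. *)
have prot a b : exists i, p b - p a = eis_rot i (b - a).
  have := FW.2 ((1%R, a) : p3_model)^-1%g (1, b).
  rewrite (weak_cayleyV FW) !F1E !p3_modelV !p3_modelM addNr !raddfN /=.
  rewrite -!eis_rotD subrr !eis_rot0 F0 ![- _ + _]addrC.
  by move=> /conjugate_model0.
have p0 a : exists i, p a - p 0 = eis_rot i a.
  by have := prot 0 a; rewrite subr0.
have [|a b|u [e [u1 e1 pE]]] := @isometry_lin (fun a => p a - p 0).
- exact: subrr.
- have [i] := prot b a; rewrite opprB addrA subrK => ->.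
  exact: enorm_rot.
have [|j jE] := @lin_pointwise_rot u (u + eis_rot e u).
  by move=> a; rewrite -pE.
have {u e u1 e1 jE} pE a : p a = p 0 + eis_rot j a.
  by rewrite -jE -pE addrC subrK.
exists (p 0), j => -[i a]; rewrite /p3_model_tau /=.
elim/Z3_ind: i => /=; first by rewrite F0 /p3_cocycle /= addr0.
  by rewrite F1E pE addrC.
(* The remaining coset consists of inverses of elements of the coset of rho, and [F] commutes with
   inversion. *)
have -> : (-1, a) = ((1%R, (- eis_rot 1 a)%R) : p3_model)^-1%g.
  by rewrite p3_modelV raddfN /= opprK -eis_rotD addNr eis_rot0.
rewrite (weak_cayleyV FW) F1E pE p3_modelV; congr pair.
rewrite raddfD !raddfN /= opprD opprK addrC -!eis_rotD.
by rewrite [X in eis_rot X _]addrAC addNr add0r.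
Qed.

End WeakCayleyModel.

(** * Generation in the model *)

Section Generation.
Local Open Scope ring_scope.

Lemma weak_cayley_model_generated (H : set (p3_model -> p3_model)) F :
    perm_group H -> automorphisms p3_model `<=` H ->
    H (fun g => g^-1)%g -> H (p3_model_tau 1) ->
  weak_cayley p3_model F -> H F.
Proof.
move=> [_ H1 HM HV] HA Hinv Htau FW.
have Htauj j : H (p3_model_tau j).
  elim/Z3_ind: j => //.
    by have -> : p3_model_tau 0 = id by apply/funext/p3_model_tau0.
  exact: HV _ _ Htau (p3_model_tauK 1) (p3_model_tauNK 1).
have fixing K : weak_cayley p3_model K -> (forall a, K (0, a) = (0, a)) ->
    (K (1, 0)).1 = 1 -> H K.
  move=> KW K0 K1; have [b [j KE]] := weak_cayley_model_normal_form KW K0 K1.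
  have -> : K = (fun g => (g.1, g.2 + p3_cocycle b g.1) : p3_model)
                  \o p3_model_tau j by apply/funext.
  by apply: HM => //; apply/HA/cocycle_automorphism.
have fixing_lattice K : weak_cayley p3_model K ->
    (forall a, K (0, a) = (0, a)) -> H K.
  move=> KW K0.
  have [n nA nE] : exists2 n, automorphisms p3_model n &
      forall i a, n (i, a) = (i, - a).
    (* This is multiplication by the unit -1 on the lattice. *)
    exists (fun g => (1 * g.1, lin (-1, 0) ((-1, 0) + eis_rot 1 (-1, 0)) g.2)).
      by apply: lin_automorphism => //; left.
    move=> i a; congr pair; first exact: mul1r.
    by apply: eisP; rewrite /= ?eisE /=; lia.
  (* The involution [ka] fixes the lattice pointwise and swaps the two other cosets. *)
  pose ka g := (n g)^-1%g.
  have kaE i a : ka (i, a) = (- i, eis_rot (- i) a).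
    by rewrite /ka nE p3_modelV raddfN opprK.
  have kaK : involutive ka.
    by case=> i a; rewrite !kaE opprK -eis_rotD subrr eis_rot0.
  have kaH : H ka by apply: (HM (fun g => g^-1)%g n) => //; apply: HA.
  have kaW : weak_cayley p3_model ka.
    apply: (@weak_cayley_comp _ (fun g => g^-1)%g n).
      exact: inv_weak_cayley.
    exact: automorphism_weak_cayley.
  have [K1|K1] := eqVneq (K (1, 0)).1 1; first exact: fixing.
  have KN1 : (K (1, 0)).1 = -1.
    have : (K (1, 0)).1 != 0 by apply: weak_cayley_model1_neq0.
    by move: K1; elim/Z3_ind: (K (1, 0)).1.
  have -> : K = ka \o (ka \o K) by apply/funext => g /=; rewrite kaK.
  apply: (HM ka) => //; apply: fixing.
  - exact: weak_cayley_comp.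
  - by move=> a /=; rewrite K0 kaE oppr0 eis_rot0.
  - have ka1 g : (ka g).1 = - g.1 by case: g => i a; rewrite kaE.
    by apply: etrans (ka1 _) _; rewrite KN1 opprK.
have [f0 fiso] := weak_cayley_model_isometry FW.
have [u [e [u1 e1 fE]]] := isometry_lin f0 fiso.
have aA := lin_automorphism u1 e1.
set al := (X in automorphisms _ X) in aA.
have [al' alK al'K] := aA.1.
have al'A := automorphism_can aA alK al'K.
have -> : F = al \o (al' \o F) by apply/funext => g /=; rewrite al'K.
apply: HM; first exact: HA.
apply: fixing_lattice.
  by apply: weak_cayley_comp => //; apply: automorphism_weak_cayley.
move=> a /=; have -> : F (0, a) = al (0, a); last exact: alK.
rewrite /al /= mulr0 -fE [LHS]surjective_pairing.
by rewrite weak_cayley_model1_eq0.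
Qed.

End Generation.

Lemma weak_cayley_iso (G H : groupType) (t : G -> H) (s : H -> G) f :
    {morph t : g h / g * h} -> cancel t s -> cancel s t ->
  weak_cayley H f -> weak_cayley G (s \o f \o t).
Proof.
move=> tM tK sK [[f' fK f'K] fW].
have sM : {morph s : g h / g * h}.
  by move=> g h; apply: (can_inj tK); rewrite tM !sK.
split=> [|g h].
  by exists (s \o f' \o t) => g; rewrite /= sK ?fK ?f'K tK.
have [k fk] := fW (t g) (t h); exists (s k).
by rewrite /= -sM -(morph_mulgJ sM) tM fk.
Qed.

(** * Isomorphism of the presented group with the model *)

Section P3Model.

Definition p3_model_gen (i : p3_gen) : p3_model :=
  match i with
  | GenX => (0, (1, 0))%R
  | GenY => (0, (0, 1))%R
  | GenRho => (1, 0)%R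
  end.

Definition to_model : p3 -> p3_model := presented_lift p3_model_gen.

Lemma p3_model_rel l r : p3_rels (l, r) ->
  gterm_eval p3_model_gen l = gterm_eval p3_model_gen r.
Proof.
by case=> [[[|]|]|] [-> ->] /=; congr pair; apply: val_inj.
Qed.

Lemma to_modelM : {morph to_model : g h / g * h}.
Proof. exact: presented_liftM p3_model_rel. Qed.

Lemma to_model_x : to_model p3_x = (0, (1, 0))%R.
Proof. exact: presented_lift_gen p3_model_rel GenX. Qed.

Lemma to_model_y : to_model p3_y = (0, (0, 1))%R.
Proof. exact: presented_lift_gen p3_model_rel GenY. Qed.

Lemma to_model_rho : to_model p3_rho = (1, 0)%R.
Proof. exact: presented_lift_gen p3_model_rel GenRho. Qed.

Lemma p3_xy_commute : commute p3_x p3_y.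
Proof.
apply/commgP/eqP; rewrite commgEl -presented_piJ -presented_piV -presented_piM.
have /presented_pi_rel : p3_rels ([~ Gen GenX, Gen GenY], 1) by left; left; left.
exact.
Qed.

Lemma p3_xJ : p3_x ^ p3_rho = p3_x^-1 * p3_y.
Proof.
rewrite -presented_piJ -presented_piV -presented_piM.
by apply: presented_pi_rel; left; left; right.
Qed.

Lemma p3_yJ : p3_y ^ p3_rho = p3_x^-1.
Proof.
rewrite -presented_piJ -presented_piV.
by apply: presented_pi_rel; left; right.
Qed.

Lemma p3_rho3 : p3_rho ^+ 3 = 1.
Proof.
have /presented_pi_rel : p3_rels (Gen GenRho ^+ 3, 1) by right.
by rewrite !expgSS !expg1 !presented_piM.
Qed.

Definition p3_translation (a : eis) : p3 := expgz p3_x a.1 * expgz p3_y a.2.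

Lemma p3_translationD a b :
  p3_translation (a + b)%R = p3_translation a * p3_translation b.
Proof.
rewrite /p3_translation !expgzD !mulgA; congr (_ * _); rewrite -!mulgA.
congr (_ * _); apply/commute_expgz/commute_sym/commute_expgz.
exact/commute_sym/p3_xy_commute.
Qed.

(** One conjugation by rho turns x^m y^n into x^(-m) y^m x^(-n) = x^(-m-n) y^m, which is the formula
    of [omega]. *)
Lemma p3_translationJ n a :
  p3_translation a ^ (p3_rho ^+ n) = p3_translation (iter n omega a).
Proof.
elim: n => [|n IHn]; first by rewrite conjg1.
rewrite expgSr conjgM IHn /= {IHn}; move: (iter n omega a) => {}a.
rewrite /p3_translation conjMg !conjXgz p3_xJ p3_yJ /= expgzMn; last first.
  by apply/commute_sym/commuteV/commute_sym/p3_xy_commute.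
rewrite !expVgz expgzD -!mulgA; congr (_ * _).
by apply: commute_expgz; apply/commute_sym/commute_expgz/p3_xy_commute.
Qed.

Definition of_model (g : p3_model) : p3 := p3_rho ^+ g.1 * p3_translation g.2.

Lemma p3_rhoX_mod n : p3_rho ^+ (n %% 3) = p3_rho ^+ n.
Proof.
by rewrite {2}(divn_eq n 3) expgnDr mulnC expgnA p3_rho3 expg1n mul1g.
Qed.

Lemma of_modelM : {morph of_model : g h / g * h}.
Proof.
move=> [i a] [j b]; rewrite p3_modelM /of_model /= p3_translationD.
rewrite -p3_translationJ p3_rhoX_mod expgnDr -!mulgA; congr (_ * _).
by rewrite mulVKg.
Qed.

(** Two homomorphisms agreeing on generators are equal, so only [x], [y] and [rho] need checking. *)
Lemma to_modelK : cancel to_model of_model.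
Proof.
apply: (@presented_hom_eq _ _ _ (of_model \o to_model) id) => //.
  by move=> g h; rewrite /= to_modelM of_modelM.
have tr0 : p3_translation 0%R = 1 by rewrite /p3_translation mulg1.
case; rewrite /= ?[to_model _]to_model_x ?[to_model _]to_model_y
  ?[to_model _]to_model_rho /of_model /=.
- by rewrite mul1g /p3_translation /= mulg1.
- by rewrite mul1g /p3_translation /= mul1g.
- by rewrite tr0 mulg1.
Qed.

Lemma p3_model_expgz (a : eis) m :
  expgz ((0%R, a) : p3_model) m = (0, (m * a.1, m * a.2))%R.
Proof.
have expN n : ((0%R, a) : p3_model) ^+ n = (0, (n%:Z * a.1, n%:Z * a.2))%R.
  elim: n => [|n IHn]; first by rewrite expg0 !mul0r.
  rewrite expgSr IHn p3_modelM addr0 eis_rot0; congr pair.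
  by apply: eisP; rewrite /= ?eisE; lia.
case: m => n; rewrite /= expN // p3_modelV oppr0 eis_rot0 NegzE; congr pair.
by apply: eisP; rewrite /= ?eisE /=; lia.
Qed.

Lemma of_modelK : cancel of_model to_model.
Proof.
move=> [i a]; rewrite /of_model /p3_translation !to_modelM.
rewrite (morph_mulgX _ to_modelM) !(morph_expgz _ to_modelM).
rewrite to_model_x to_model_y to_model_rho !p3_model_expgz /= !p3_modelM.
have -> : ((1%R, 0%R) : p3_model) ^+ i = (i, 0%R).
  by elim/Z3_ind: i; congr pair; apply: val_inj.
rewrite p3_modelM; congr pair; first by rewrite !addr0.
by apply: eisP; rewrite /= ?eisE /=; lia.
Qed.

Lemma p3_AE g : p3_A g <-> (to_model g).1 = 0%R.
Proof.
split=> [|g0].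
  pose L : set p3 := [set h | (to_model h).1 = 0%R].
  have LE h : (h \in mem L) = ((to_model h).1 == 0%R).
    by apply/asboolP/eqP.
  (* The kernel [L] of the rotation part is a subgroup containing both generators, hence contains
     [p3_A]. *)
  move/(_ L); apply; split; last first.
    by move=> h [->|->]; rewrite /L /= ?to_model_x ?to_model_y.
  split; first by rewrite LE (morph_mulg1 to_modelM).
  move=> h k; rewrite !LE => /eqP h0 /eqP k0.
  by rewrite to_modelM (morph_mulgV to_modelM) /= h0 k0 oppr0 addr0.
move=> H [[H1 HF] HS].
have HV h : h \in mem H -> h^-1 \in mem H by exact: group_closedV.
have HM h k : h \in mem H -> k \in mem H -> h * k \in mem H.
  exact: (group_closedM (conj H1 HF)).
have HX h m : h \in mem H -> expgz h m \in mem H.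
  move=> hH; have hX n : h ^+ n \in mem H.
    by elim: n => // n IHn; rewrite expgS HM.
  by case: m => n; [exact: hX | exact/HV/hX].
suff : g \in mem H by move/asboolP.
(* With zero rotation part, the normal form of [g] reduces to x^m y^n. *)
rewrite -(to_modelK g) /of_model g0 mul1g /p3_translation.
by apply: HM; apply: HX; apply/asboolP/HS; [left | right].
Qed.

Lemma to_model_tau g : to_model (p3_tau g) = p3_model_tau 1%R (to_model g).
Proof.
rewrite /p3_tau /p3_model_tau.
(* The two cosets in the definition of [p3_tau] are exactly the elements with nonzero rotation
   part. *)
have -> : (g \in [set a * p3_rho | a in p3_A] `|`
               [set a * p3_rho ^+ 2 | a in p3_A]) = ((to_model g).1 != 0%R).
  apply/asboolP/idP => [|g0].
    case=> -[a /p3_AE a0 <-]; rewrite !to_modelM ?(morph_mulgX _ to_modelM);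
      by rewrite to_model_rho /= a0.
  have [g1|g1] := eqVneq (to_model g).1 1%R; [left|right].
    exists (g * p3_rho^-1); last by rewrite mulgVK.
    apply/p3_AE; rewrite to_modelM (morph_mulgV to_modelM) to_model_rho /= g1.
    exact: subrr.
  exists (g * p3_rho ^- 2); last by rewrite mulgVK.
  apply/p3_AE; rewrite to_modelM (morph_mulgV to_modelM).
  rewrite (morph_mulgX _ to_modelM) to_model_rho /=.
  by move: g0 g1; elim/Z3_ind: (to_model g).1 => // _ _; apply: val_inj.
case: eqVneq => //= g0; rewrite (morph_mulgJ to_modelM) to_model_rho.
by case: (to_model g) => i a; rewrite p3_modelJ /= raddf0 subr0 addr0.
Qed.

Lemma p3_tauE : p3_tau = of_model \o p3_model_tau 1%R \o to_model.
Proof. by apply/funext => g; rewrite /= -to_model_tau to_modelK. Qed.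

Lemma p3_tau_weak_cayley_unit : @weak_cayley_unit p3 p3_tau.
Proof.
rewrite p3_tauE; have [tW [t' [tW' tK t'K]]] := p3_model_tau_weak_cayley_unit 1%R.
have W f : weak_cayley p3_model f -> weak_cayley p3 (of_model \o f \o to_model).
  exact: weak_cayley_iso to_modelM to_modelK of_modelK.
split; first exact: W.
exists (of_model \o t' \o to_model); split; first exact: W.
  by move=> g; rewrite /= of_modelK tK to_modelK.
by move=> g; rewrite /= of_modelK t'K to_modelK.
Qed.

End P3Model.

(** * Transport to the presented group and conclusion *)

Lemma perm_group_iso (G K : groupType) (s : G -> K) (t : K -> G)
    (H : set (K -> K)) : cancel s t -> cancel t s ->
  perm_group H -> perm_group [set f : G -> G | H (s \o f \o t)].
Proof.
move=> sK tK [HB H1 HM HV]; split.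
- move=> f /HB[f' fK f'K]; exists (t \o f' \o s) => g /=.
    by apply: (can_inj sK); rewrite tK -[X in f' (s (f X))]sK [LHS]fK.
  by apply: (can_inj sK); have := f'K (s g); rewrite /= => ->.
- by rewrite /= (_ : s \o id \o t = id) //; apply/funext/tK.
- move=> f1 f2 Hf1 Hf2; have := HM _ _ Hf1 Hf2; congr H.
  by apply/funext => g /=; rewrite sK.
- move=> f1 f2 Hf1 K1 K2; apply: (HV _ _ Hf1) => g /=.
    by rewrite sK K1 tK.
  by rewrite sK K2 tK.
Qed.

Theorem corollary6p12 :
  weak_cayley p3 p3_tau /\
  weak_cayley p3 = perm_generated (weak_cayley0 p3 `|` [set p3_tau]).
Proof.
split; first by case: p3_tau_weak_cayley_unit.
apply/seteqP; split=> [f fW H [HG HS] | f].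
  have H0 : automorphisms p3 `|` [set (fun g => g^-1)] `<=` H.
    by move=> h Sh; apply: HS; left; apply: sub_gen_smallest.
  have -> : f = of_model \o (to_model \o f \o of_model) \o to_model.
    by apply/funext => g /=; rewrite !to_modelK.
  (* Pulling [H] back to the model reduces the claim to generation there. *)
  pose K := [set k | H (of_model \o k \o to_model)].
  apply: (@weak_cayley_model_generated K).
  - exact: perm_group_iso of_modelK to_modelK HG.
  - move=> k [[k' kK k'K] kM]; apply: H0; left; split.
      exists (of_model \o k' \o to_model) => g /=.
        by rewrite of_modelK kK to_modelK.
      by rewrite of_modelK k'K to_modelK.
    by move=> g h /=; rewrite to_modelM kM of_modelM.
  - apply: H0; right; apply/funext => g /=.
    by rewrite -(morph_mulgV to_modelM) to_modelK.
  - by rewrite /K /= -p3_tauE; apply: HS; right.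
  exact: weak_cayley_iso of_modelM of_modelK to_modelK fW.
(* Conversely, the invertible weak Cayley maps form a permutation group containing all the
   generators. *)
move=> /(_ (@weak_cayley_unit p3)) [] //; split.
  exact: perm_group_weak_cayley_unit.
move=> h [|->]; last exact: p3_tau_weak_cayley_unit.
apply: smallest_sub; first exact: perm_group_weak_cayley_unit.
move=> k [|->]; first exact: automorphisms_weak_cayley_unit.
exact: inv_weak_cayley_unit.
Qed.
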